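(* Let $C\in\mathbb{R}^{m\times m}$ be symmetric positive definite and let $A\in\mathbb{R}^{m\times m}$ be strictly dissipative. Then the unique solution $X\in\mathbb{R}^{m\times m}$ to the Lyapunov equation $AX+XA^T=-C$ satisfies $$\kappa_2(X)\le \kappa_2(A+A^T)\,\kappa_2(C).$$
   Context: A real square matrix $M$ is called strictly dissipative if its symmetric part $\frac{M+M^T}{2}$ is negative definite. For a nonsingular matrix $M$, $\kappa_2(M)=\|M\|_2\|M^{-1}\|_2$ is the spectral condition number. *)

(* Defs.v *)
From mathcomp Require Import all_boot all_order all_algebra sesquilinear.
From mathcomp Require Import classical_sets reals.

Set Implicit Arguments.
Unset Strict Implicit.
Unset Printing Implicit Defensive.

Import Order.TTheory GRing.Theory Num.Theory.

Local Open Scope classical_set_scope.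
Local Open Scope ring_scope.

Definition norm2 (R : realType) (m : nat) (v : 'cV[R]_m) : R :=
  Num.sqrt (\sum_(i < m) v i 0 ^+ 2).

(* The set is bounded above; it is empty, with supremum 0, only if m = 0. *)
Definition mxnorm2 (R : realType) (m : nat) (M : 'M[R]_m) : R :=
  sup [set norm2 (M *m v) | v in [set v : 'cV[R]_m | norm2 v = 1]].

(* Meaningful only for M \in unitmx: otherwise invmx M = M. *)
Definition cond2 (R : realType) (m : nat) (M : 'M[R]_m) : R :=
  mxnorm2 M * mxnorm2 (invmx M).

Definition posdefmx (R : realType) (m : nat) (M : 'M[R]_m) : Prop :=
  M \is symmetricmx /\
  forall v : 'cV[R]_m, v != 0 -> 0 < (v^T *m M *m v) 0 0.

Definition negdefmx (R : realType) (m : nat) (M : 'M[R]_m) : Prop :=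
  M \is symmetricmx /\
  forall v : 'cV[R]_m, v != 0 -> (v^T *m M *m v) 0 0 < 0.

Definition sympart (R : realType) (m : nat) (M : 'M[R]_m) : 'M[R]_m :=
  2^-1 *: (M + M^T).

Definition strictly_dissipative (R : realType) (m : nat) (M : 'M[R]_m) : Prop :=
  negdefmx (sympart M).

Definition lyapunov_solution (R : realType) (m : nat) (A C X : 'M[R]_m) : Prop :=
  A *m X + X *m A^T = - C.

(* Main.v *)
(* If X v = l v then testing the Lyapunov equation on v gives
   l * v^T (A + A^T) v = - v^T C v, which bounds every eigenvalue l of X by
   Rayleigh quotients of C and P = - (A + A^T).  In terms of quadratic forms,
   K - X and L X - 1 are positive semidefinite for K = |C| |P^-1| and
   L = |P| |C^-1|, hence |X| <= K and |X^-1| <= L.  The extreme eigenvalue is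
   obtained from the infimum of the Rayleigh quotient, without the spectral
   theorem.  Uniqueness holds since tr (Y^T (A Y + Y A^T)) < 0 for Y != 0, and
   existence follows by dimension. *)
Require Import Defs.
From mathcomp Require Import all_boot all_order all_algebra sesquilinear.
From mathcomp Require Import ring lra.
From mathcomp Require Import boolp classical_sets reals.

Import Order.TTheory GRing.Theory Num.Theory.

Local Open Scope ring_scope.

Definition bil {R : realType} {m : nat} (M : 'M[R]_m) (u v : 'cV[R]_m) : R :=
  (u^T *m M *m v) 0 0.

Definition psd {R : realType} {m : nat} (M : 'M[R]_m) : Prop :=
  forall v, 0 <= bil M v v.

Lemma bilDm {R : realType} {m} (M N : 'M[R]_m) u v :
  bil (M + N) u v = bil M u v + bil N u v.
Proof. by rewrite /bil mulmxDr mulmxDl mxE. Qed.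

Lemma bilNm {R : realType} {m} (M : 'M[R]_m) u v : bil (- M) u v = - bil M u v.
Proof. by rewrite /bil mulmxN mulNmx mxE. Qed.

Lemma bilZm {R : realType} {m} a (M : 'M[R]_m) u v :
  bil (a *: M) u v = a * bil M u v.
Proof. by rewrite /bil -scalemxAr -scalemxAl mxE. Qed.

Lemma bilDr {R : realType} {m} (M : 'M[R]_m) u v w :
  bil M u (v + w) = bil M u v + bil M u w.
Proof. by rewrite /bil mulmxDr mxE. Qed.

Lemma bilZr {R : realType} {m} (M : 'M[R]_m) a u v :
  bil M u (a *: v) = a * bil M u v.
Proof. by rewrite /bil -scalemxAr mxE. Qed.

Lemma bil_tr {R : realType} {m} (M : 'M[R]_m) u v : bil M^T u v = bil M v u.
Proof.
rewrite /bil; have -> : u^T *m M^T *m v = (v^T *m M *m u)^T.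
  by rewrite !trmx_mul trmxK mulmxA.
by rewrite mxE.
Qed.

Lemma bilDl {R : realType} {m} (M : 'M[R]_m) u v w :
  bil M (u + v) w = bil M u w + bil M v w.
Proof. by rewrite -!(bil_tr M) bilDr. Qed.

Lemma bilZl {R : realType} {m} (M : 'M[R]_m) a u v :
  bil M (a *: u) v = a * bil M u v.
Proof. by rewrite -!(bil_tr M) bilZr. Qed.

Lemma bilMr {R : realType} {m} (M N : 'M[R]_m) u v :
  bil (M *m N) u v = bil M u (N *m v).
Proof. by rewrite /bil !mulmxA. Qed.

Lemma bilMl {R : realType} {m} (M N : 'M[R]_m) u v :
  bil (M *m N) u v = bil N (M^T *m u) v.
Proof. by rewrite /bil trmx_mul trmxK !mulmxA. Qed.

Lemma bil1E {R : realType} {m} (u : 'cV[R]_m) :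
  bil 1%:M u u = \sum_i u i 0 ^+ 2.
Proof.
by rewrite /bil mulmx1 mxE; apply: eq_bigr => i _; rewrite mxE expr2.
Qed.

Lemma psd1 {R : realType} {m} : psd (1%:M : 'M[R]_m).
Proof. by move=> v; rewrite bil1E sumr_ge0 // => i _; rewrite sqr_ge0. Qed.

Lemma bil1_eq0 {R : realType} {m} (v : 'cV[R]_m) : (bil 1%:M v v == 0) = (v == 0).
Proof.
apply/idP/eqP => [|->]; last by rewrite /bil mulmx0 mxE.
rewrite bil1E psumr_eq0 => [/allP h|i _]; last exact: sqr_ge0.
apply/matrixP => i j; rewrite ord1 mxE; apply/eqP.
by rewrite -sqrf_eq0; apply: (implyP (h i _)); rewrite ?mem_index_enum.
Qed.

Lemma bil1_gt0 {R : realType} {m} (v : 'cV[R]_m) : v != 0 -> 0 < bil 1%:M v v.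
Proof. by move=> v0; rewrite lt_neqAle psd1 eq_sym bil1_eq0 v0. Qed.

Lemma norm2_sqr {R : realType} {m} (v : 'cV[R]_m) : norm2 v ^+ 2 = bil 1%:M v v.
Proof. by rewrite /norm2 -bil1E sqr_sqrtr // psd1. Qed.

Lemma norm2_ge0 {R : realType} {m} (v : 'cV[R]_m) : 0 <= norm2 v.
Proof. exact: sqrtr_ge0. Qed.

Lemma norm2_gt0 {R : realType} {m} (v : 'cV[R]_m) : v != 0 -> 0 < norm2 v.
Proof. by move=> v0; rewrite /norm2 sqrtr_gt0 -bil1E bil1_gt0. Qed.

Lemma norm2_0 {R : realType} {m} : norm2 (0 : 'cV[R]_m) = 0.
Proof. by apply/eqP; rewrite -sqrf_eq0 norm2_sqr bil1_eq0. Qed.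

Lemma norm2Z {R : realType} {m} a (v : 'cV[R]_m) : 0 <= a -> norm2 (a *: v) = a * norm2 v.
Proof.
move=> a0; apply/eqP; rewrite -(@eqrXn2 _ 2) ?mulr_ge0 ?norm2_ge0 //.
by rewrite exprMn !norm2_sqr bilZl bilZr mulrA expr2.
Qed.

Lemma psd_CauchySchwarz {R : realType} {m} (P : 'M[R]_m) u v : P^T = P -> psd P ->
  bil P u v ^+ 2 <= bil P u u * bil P v v.
Proof.
move=> symP psdP; have := psdP (bil P v v *: u + - bil P u v *: v).
have := psdP (bil P u v *: u + - (bil P u u + 1) *: v).
rewrite !bilDl !bilDr !bilZl !bilZr -(bil_tr P v u) symP.
move: (psdP u) (psdP v); set a := bil P u u; set b := bil P u v; set c := bil P v v.
move=> a0; rewrite le_eqVlt => /predU1P[<-|c0].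
  rewrite mulr0 => h _; nra.
move=> _ h; rewrite -(ler_pM2l c0) -subr_ge0; lra.
Qed.

Lemma bil1_le {R : realType} {m} (u v : 'cV[R]_m) : bil 1%:M u v <= norm2 u * norm2 v.
Proof.
rewrite (le_trans (ler_norm _)) // -(@ler_pXn2r _ 2) ?nnegrE ?mulr_ge0 ?norm2_ge0 //.
rewrite real_normK ?num_real // exprMn !norm2_sqr.
exact: psd_CauchySchwarz (trmx1 _ _) psd1.
Qed.

Lemma mxnorm2_has_ubound {R : realType} {m} (M : 'M[R]_m) :
  has_ubound [set norm2 (M *m v) | v in [set v : 'cV[R]_m | norm2 v = 1]].
Proof.
exists (Num.sqrt (\sum_i norm2 (row i M)^T ^+ 2)) => _ [v /= v1 <-].
apply: ler_wsqrtr; apply: ler_sum => i _.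
have -> : (M *m v) i 0 = bil 1%:M (row i M)^T v.
  by rewrite /bil mulmx1 trmxK -row_mul [RHS]mxE.
rewrite (le_trans (psd_CauchySchwarz _ _ _ (trmx1 _ _) psd1)) //.
by rewrite -!norm2_sqr v1 expr1n mulr1.
Qed.

Lemma mxnorm2_ge0 {R : realType} {m} (M : 'M[R]_m) : 0 <= mxnorm2 M.
Proof.
have [[v v1]|no] := pselect (exists v : 'cV[R]_m, norm2 v = 1).
  apply: (le_trans (norm2_ge0 (M *m v))).
  by apply: (ub_le_sup (mxnorm2_has_ubound M)); exists v.
rewrite /mxnorm2 sup_out // => -[[_ [v v1 _]] _].
by apply: no; exists v.
Qed.

Lemma mxnorm2N {R : realType} {m} (M : 'M[R]_m) : mxnorm2 (- M) = mxnorm2 M.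
Proof.
have nN v : norm2 (- M *m v) = norm2 (M *m v).
  by rewrite mulNmx; congr Num.sqrt; apply: eq_bigr => i _; rewrite mxE sqrrN.
rewrite /mxnorm2; congr sup; apply/seteqP.
by split=> _ [v v1 <-]; exists v; rewrite // nN.
Qed.

Lemma norm2_mulmx_le {R : realType} {m} (M : 'M[R]_m) v :
  norm2 (M *m v) <= mxnorm2 M * norm2 v.
Proof.
have [->|v0] := eqVneq v 0; first by rewrite mulmx0 norm2_0 mulr0.
have nv := norm2_gt0 v v0; have nvV : 0 <= (norm2 v)^-1 by rewrite invr_ge0 ltW.
rewrite -ler_pdivrMr // mulrC -norm2Z // scalemxAr.
apply: (ub_le_sup (mxnorm2_has_ubound M)); exists ((norm2 v)^-1 *: v) => //=.
by rewrite norm2Z // mulVf // gt_eqF.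
Qed.

Lemma mxnorm2_le {R : realType} {m} (M : 'M[R]_m) K : 0 <= K ->
  (forall v, norm2 (M *m v) <= K * norm2 v) -> mxnorm2 M <= K.
Proof.
move=> K0 leK; have [[v v1]|no] := pselect (exists v : 'cV[R]_m, norm2 v = 1).
  apply: ge_sup; first by exists (norm2 (M *m v)); exists v.
  by move=> _ [w w1 <-]; have := leK w; rewrite w1 mulr1.
rewrite /mxnorm2 sup_out // => -[[_ [v v1 _]] _].
by apply: no; exists v.
Qed.

Lemma bil_le_mxnorm2 {R : realType} {m} (M : 'M[R]_m) v :
  bil M v v <= mxnorm2 M * bil 1%:M v v.
Proof.
rewrite -(mul1mx M) bilMr mul1mx (le_trans (bil1_le _ _)) //.
by rewrite -norm2_sqr expr2 mulrA mulrC ler_wpM2r ?norm2_ge0 ?norm2_mulmx_le.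
Qed.

(* Cauchy-Schwarz for P, applied to invmx P *m v and v. *)
Lemma psd_unit_coercive {R : realType} {m} (P : 'M[R]_m) v :
  P^T = P -> psd P -> P \in unitmx ->
  bil 1%:M v v <= mxnorm2 (invmx P) * bil P v v.
Proof.
move=> symP psdP uP; have [->|v0] := eqVneq v 0.
  by rewrite /bil !mulmx0 !mxE mulr0.
have symV : (invmx P)^T = invmx P by rewrite trmx_inv symP.
have := psd_CauchySchwarz _ (invmx P *m v) v symP psdP.
rewrite -bilMr mulmxV // -{1 2}symV -!bilMl mulVmx // mulmx1 => CS.
rewrite -(ler_pM2l (bil1_gt0 _ v0)) -expr2 (le_trans CS) // mulrA.
by rewrite ler_wpM2r ?psdP // mulrC bil_le_mxnorm2.
Qed.

Lemma psd_mxnorm2_le {R : realType} {m} (P : 'M[R]_m) K :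
  P^T = P -> psd P -> 0 <= K -> psd (K *: 1%:M - P) -> mxnorm2 P <= K.
Proof.
move=> symP psdP K0 leK.
have {}leK v : bil P v v <= K * bil 1%:M v v.
  by have := leK v; rewrite bilDm bilNm bilZm subr_ge0.
apply: mxnorm2_le => // v; have [->|Pv0] := eqVneq (P *m v) 0.
  by rewrite norm2_0 mulr_ge0 ?norm2_ge0.
rewrite -(@ler_pXn2r _ 2) ?nnegrE ?mulr_ge0 ?norm2_ge0 // exprMn !norm2_sqr.
rewrite -(ler_pM2l (bil1_gt0 _ Pv0)).
have Pvv : bil P (P *m v) v = bil 1%:M (P *m v) (P *m v) by rewrite -bilMr mul1mx.
have := psd_CauchySchwarz _ (P *m v) v symP psdP.
rewrite Pvv -expr2 => /le_trans; apply.
apply: (le_trans (ler_pM (psdP _) (psdP _) (leK (P *m v)) (leK v))).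
by rewrite le_eqVlt; apply/orP; left; apply/eqP; ring.
Qed.

Lemma coercive_unitmx {R : realType} {m} (P : 'M[R]_m) :
  (forall v, v != 0 -> 0 < bil P v v) -> P \in unitmx.
Proof.
move=> posP; rewrite -row_free_unit; apply: inj_row_free => v vP0.
apply: trmx_inj; rewrite trmx0; apply/eqP/negP => /negP /posP.
by rewrite /bil trmxK vP0 mul0mx mxE ltxx.
Qed.

Lemma coercive_mxnorm2_invmx_le {R : realType} {m} (P : 'M[R]_m) K :
  P \in unitmx -> 0 <= K -> psd (K *: P - 1%:M) -> mxnorm2 (invmx P) <= K.
Proof.
move=> uP K0 leK; apply: mxnorm2_le => // v; set w := invmx P *m v.
have -> : v = P *m w by rewrite /w mulmxA mulmxV // mul1mx.
have [->|w0] := eqVneq w 0; first by rewrite norm2_0 mulr_ge0 ?norm2_ge0.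
rewrite -(ler_pM2l (norm2_gt0 _ w0)) -expr2 norm2_sqr.
have := leK w; rewrite bilDm bilNm bilZm subr_ge0 => /le_trans; apply.
by rewrite -[P in bil P]mul1mx bilMr mulrCA ler_wpM2l // bil1_le.
Qed.

(* The infimum of the Rayleigh quotient of Y is an eigenvalue l of Y, since
   otherwise Y - l would be invertible, hence coercive; testing the Lyapunov
   equation on an eigenvector v gives l * bil (A + A^T) v v <= 0. *)
Lemma lyapunov_psd {R : realType} {m} (A Y : 'M[R]_m) :
  (forall v, v != 0 -> bil (A + A^T) v v < 0) -> Y^T = Y ->
  psd (- (A *m Y + Y *m A^T)) -> psd Y.
Proof.
move=> negA symY psdD v; rewrite leNgt; apply/negP => Yv.
pose E : set R := [set bil Y w w | w in [set w : 'cV[R]_m | norm2 w = 1]]%classic.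
have normE w : w != 0 -> E (bil Y w w / bil 1%:M w w).
  move=> w0; have nw := norm2_gt0 _ w0.
  have nwV : 0 <= (norm2 w)^-1 by rewrite invr_ge0 ltW.
  exists ((norm2 w)^-1 *: w); first by rewrite /= norm2Z // mulVf // gt_eqF.
  by rewrite bilZl bilZr -norm2_sqr; field; rewrite gt_eqF.
have v0 : v != 0 by apply/eqP => v0; move: Yv; rewrite v0 /bil mulmx0 mxE ltxx.
have lbE : has_lbound E.
  exists (- mxnorm2 (- Y)) => _ [w /= w1 <-].
  have := bil_le_mxnorm2 (- Y) w; rewrite bilNm -norm2_sqr w1 expr1n mulr1 => h; lra.
pose l := inf E; pose P := Y - l *: 1%:M.
have PE w : bil P w w = bil Y w w - l * bil 1%:M w w.
  by rewrite /P bilDm bilNm bilZm.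
have l0 : l < 0.
  apply: (le_lt_trans (ge_inf lbE (normE v v0))).
  by rewrite pmulr_llt0 // invr_gt0 bil1_gt0.
have psdP : psd P.
  move=> w; have [->|w0] := eqVneq w 0; first by rewrite /bil mulmx0 mxE.
  by rewrite PE subr_ge0 -ler_pdivlMr ?bil1_gt0 // ge_inf //; exact: normE.
have symP : P^T = P by rewrite /P linearB /= symY linearZ /= trmx1.
have nuP : P \notin unitmx.
  apply/negP => uP; pose K := mxnorm2 (invmx P) + 1.
  have K0 : 0 < K by rewrite ltr_wpDl ?mxnorm2_ge0.
  suff : l + K^-1 <= l by rewrite gerDl leNgt invr_gt0 K0.
  apply: lb_le_inf; first by exists (bil Y v v / bil 1%:M v v); exact: normE.
  move=> _ [w /= w1 <-].
  have := psd_unit_coercive P w symP psdP uP; rewrite PE -norm2_sqr w1 expr1n mulr1.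
  move=> h; rewrite -lerBrDl -[K^-1]mul1r ler_pdivrMr // mulrC.
  apply: le_trans h _; rewrite ler_wpM2r ?lerDl //.
  by have := psdP w; rewrite PE -norm2_sqr w1 expr1n mulr1.
have [w w0 Pw] : exists2 w : 'cV[R]_m, w != 0 & P *m w = 0.
  apply: contrapT => no; move/negP: nuP; apply.
  rewrite -row_free_unit; apply: inj_row_free => w wP.
  apply: trmx_inj; rewrite trmx0; apply: contrapT => w0; apply: no.
  exists w^T; first exact/eqP.
  by rewrite -{1}symP -trmx_mul wP trmx0.
have Yw : Y *m w = l *: w.
  by move/eqP: Pw; rewrite /P mulmxBl -scalemxAl mul1mx subr_eq0 => /eqP.
have := psdD w; rewrite bilNm bilDm bilMr bilMl symY Yw bilZl bilZr -mulrDr -bilDm.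
by rewrite oppr_ge0 leNgt nmulr_rgt0 // negA.
Qed.

Lemma lyapunov_ker {R : realType} {m} (A Y : 'M[R]_m) :
  (forall v, v != 0 -> bil A v v < 0) -> A *m Y + Y *m A^T = 0 -> Y = 0.
Proof.
move=> negA eqY.
have npA v : bil A v v <= 0.
  have [->|v0] := eqVneq v 0; first by rewrite /bil mulmx0 mxE.
  exact/ltW/negA.
have trE (Z : 'M[R]_m) : \tr (Z^T *m A *m Z) = \sum_j bil A (col j Z) (col j Z).
  apply: eq_bigr => j _; rewrite /bil tr_col -row_mul [LHS]mxE [RHS]mxE.
  by apply: eq_bigr => k _; congr (_ * _); rewrite [RHS]mxE.
have tr_le0 (Z : 'M[R]_m) : \tr (Z^T *m A *m Z) <= 0.
  by rewrite trE sumr_le0.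
have tr0 : \tr (Y^T *m A *m Y) + \tr (Y^T^T *m A *m Y^T) = 0.
  have <- : \tr (Y^T *m (A *m Y + Y *m A^T)) = 0 by rewrite eqY mulmx0 mxtrace0.
  rewrite mulmxDr mxtraceD mulmxA trmxK; congr (_ + _).
  by rewrite -[RHS]mxtrace_tr !trmx_mul !trmxK -mulmxA mxtrace_mulC.
have /eqP : \sum_j - bil A (col j Y) (col j Y) = 0.
  rewrite sumrN -trE; have := tr_le0 Y; have := tr_le0 Y^T; lra.
rewrite psumr_eq0 => [/allP colY0|j _]; last by rewrite oppr_ge0.
apply/matrixP => i j; have /implyP/(_ isT) := colY0 j (mem_index_enum j).
rewrite oppr_eq0 => Aj0; have [cj0|/negA] := eqVneq (col j Y) 0.
  by have := congr1 (fun u : 'cV_m => u i 0) cj0; rewrite !mxE.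
by rewrite (eqP Aj0) ltxx.
Qed.

Lemma lyapunov_solution_ex {R : realType} {m} (A C : 'M[R]_m) :
  (forall v, v != 0 -> bil A v v < 0) -> exists X, lyapunov_solution A C X.
Proof.
move=> negA; pose L := lin_mx (mulmx A) + lin_mx (mulmxr A^T) : 'M[R]_(m * m).
have LE (Y : 'M[R]_m) : mxvec Y *m L = mxvec (A *m Y + Y *m A^T).
  by rewrite mulmxDr !mul_vec_lin linearD.
have uL : L \in unitmx.
  rewrite -row_free_unit; apply: inj_row_free => v; rewrite -[v]vec_mxK LE => /eqP.
  rewrite mxvec_eq0 => /eqP /(lyapunov_ker _ _ negA) ->; exact: linear0.
exists (vec_mx (mxvec (- C) *m invmx L)).
by apply: (can_inj mxvecK); rewrite -LE vec_mxK mulmxKV.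
Qed.

Theorem theorem4 (R : realType) (m : nat) (A C : 'M[R]_m)
    (hC : posdefmx C) (hA : strictly_dissipative A) :
  (exists! X : 'M[R]_m, lyapunov_solution A C X) /\
  (forall X : 'M[R]_m, lyapunov_solution A C X ->
     X \in unitmx /\ cond2 X <= cond2 (A + A^T) * cond2 C).
Proof.
have [/is_hermitianmxP symC posC] := hC; have {hA} [_ negS] := hA.
rewrite expr0 scale1r map_mx_id // in symC.
have negA v : v != 0 -> bil A v v < 0.
  move=> /negS; rewrite -/(bil _ v v) bilZm bilDm bil_tr; lra.
have uniqX X Y : lyapunov_solution A C X -> lyapunov_solution A C Y -> X = Y.
  move=> eqX eqY; apply/eqP; rewrite -subr_eq0; apply/eqP/(lyapunov_ker A) => //.
  by rewrite mulmxBr mulmxBl addrACA -opprD eqX eqY subrr.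
split=> [|X eqX].
  have [X eqX] := lyapunov_solution_ex A C negA.
  by exists X; split=> // Y; exact: uniqX.
have symX : X^T = X.
  apply: uniqX => //; rewrite /lyapunov_solution [in RHS]symC -linearN /= -eqX.
  by rewrite linearD /= !trmx_mul trmxK addrC.
pose P := - (A + A^T).
have posP v : v != 0 -> 0 < bil P v v.
  by move=> /negA; rewrite bilNm bilDm bil_tr; lra.
have symP : P^T = P by rewrite /P linearN linearD /= trmxK addrC.
have psdW (M : 'M[R]_m) : (forall v, v != 0 -> 0 < bil M v v) -> psd M.
  move=> posM v; have [->|v0] := eqVneq v 0; first by rewrite /bil mulmx0 mxE.
  exact/ltW/posM.
have psdP := psdW _ posP; have psdC := psdW _ posC.
have uP := coercive_unitmx _ posP; have uC := coercive_unitmx _ posC.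
have lyap_psd Y : Y^T = Y -> psd (- (A *m Y + Y *m A^T)) -> psd Y.
  by apply: lyapunov_psd => v /negA; rewrite bilDm bil_tr; lra.
have lyapD a b : A *m (a *: X + b *: 1%:M) + (a *: X + b *: 1%:M) *m A^T
    = - (a *: C + b *: P).
  rewrite mulmxDr mulmxDl -!scalemxAr -!scalemxAl mulmx1 mul1mx addrACA.
  by rewrite -!scalerDr eqX /P !scalerN opprD opprK.
have symD a b : (a *: X + b *: 1%:M)^T = a *: X + b *: 1%:M.
  by rewrite linearD !linearZ /= symX trmx1.
have psdX : psd X.
  apply: lyap_psd => // v; rewrite eqX opprK; exact: psdC.
set K := mxnorm2 C * mxnorm2 (invmx P).
set L := mxnorm2 P * mxnorm2 (invmx C).
have K0 : 0 <= K by rewrite mulr_ge0 ?mxnorm2_ge0.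
have L0 : 0 <= L by rewrite mulr_ge0 ?mxnorm2_ge0.
have leK : psd (K *: 1%:M - X).
  rewrite addrC -scaleN1r; apply: lyap_psd => // v.
  rewrite lyapD opprK bilDm !bilZm mulN1r addrC subr_ge0.
  rewrite (le_trans (bil_le_mxnorm2 _ _)) // -mulrA ler_wpM2l ?mxnorm2_ge0 //.
  exact: psd_unit_coercive.
have leL : psd (L *: X - 1%:M).
  rewrite -scaleN1r; apply: lyap_psd => // v.
  rewrite lyapD opprK bilDm !bilZm mulN1r subr_ge0.
  rewrite (le_trans (bil_le_mxnorm2 _ _)) // -mulrA ler_wpM2l ?mxnorm2_ge0 //.
  exact: psd_unit_coercive.
have uX : X \in unitmx.
  apply: coercive_unitmx => v v0; rewrite lt_neqAle psdX andbT eq_sym.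
  apply/negP => /eqP Xv0; have := leL v.
  by rewrite bilDm bilNm bilZm Xv0 mulr0 add0r oppr_ge0 leNgt bil1_gt0.
split=> //; rewrite /cond2.
have -> : mxnorm2 (A + A^T) = mxnorm2 P by rewrite mxnorm2N.
have -> : mxnorm2 (invmx (A + A^T)) = mxnorm2 (invmx P).
  by rewrite /P -scaleN1r invmxZ ?scaleN1r // invrN1 scaleN1r mxnorm2N.
have -> : mxnorm2 P * mxnorm2 (invmx P) * (mxnorm2 C * mxnorm2 (invmx C)) = K * L.
  by rewrite /K /L; ring.
rewrite ler_pM ?mxnorm2_ge0 //; first exact: psd_mxnorm2_le.
exact: coercive_mxnorm2_invmx_le.
Qed.
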